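(* Let $S$ be a finite set, $\xi,\eta:S\to\mathbb{Z}$ functions such that $\xi$, $\eta$ and the constant function $1$ are linearly independent, and $r:S\times S\times S\times S\to[0,\infty)$ a rate function satisfying conditions (A), (C) and (D) of the context, with $\pi$ the probability measure of condition (C). For $\theta,\tau\in\mathbb{R}$ let $\Phi(\theta,\tau)$ and $\Psi(\theta,\tau)$ be the macroscopic fluxes expressed in the variables $(\theta,\tau)$, as defined in the context. Then there exists a potential function $U:\mathbb{R}^2\to\mathbb{R}$, $(\theta,\tau)\mapsto U(\theta,\tau)$, such that $$\Phi(\theta,\tau)=U'_\theta(\theta,\tau),\qquad \Psi(\theta,\tau)=U'_\tau(\theta,\tau)\qquad\text{for all }(\theta,\tau)\in\mathbb{R}^2,$$ or, equivalently, $$\Phi'_\tau(\theta,\tau)=\Psi'_\theta(\theta,\tau)\qquad\text{for all }(\theta,\tau)\in\mathbb{R}^2 .$$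
   Context: Conditions. (A) If $r(\omega_1,\omega_2;\omega_1',\omega_2')>0$ then $\xi(\omega_1)+\xi(\omega_2)=\xi(\omega_1')+\xi(\omega_2')$ and $\eta(\omega_1)+\eta(\omega_2)=\eta(\omega_1')+\eta(\omega_2')$. (C) There is a probability measure $\pi$ on $S$ such that for all $\omega_1,\omega_2,\omega_1',\omega_2'\in S$: $\pi(\omega_1)\pi(\omega_2)\,r(\omega_1,\omega_2;\omega_1',\omega_2')=\pi(\omega_2')\pi(\omega_1')\,r(\omega_2',\omega_1';\omega_2,\omega_1)$. (D) With $R(\omega_1,\omega_2):=\sum_{\omega_1',\omega_2'\in S}r(\omega_1,\omega_2;\omega_1',\omega_2')$, for all $\omega_1,\omega_2,\omega_3\in S$: $R(\omega_1,\omega_2)+R(\omega_2,\omega_3)+R(\omega_3,\omega_1)=R(\omega_1,\omega_3)+R(\omega_3,\omega_2)+R(\omega_2,\omega_1)$. Notation. $G(\theta,\tau):=\log\sum_{\omega\in S}e^{\theta\xi(\omega)+\tau\eta(\omega)}\pi(\omega)$ and $\pi_{\theta,\tau}(\omega):=\pi(\omega)\exp(\theta\xi(\omega)+\tau\eta(\omega)-G(\theta,\tau))$, a probability measure on $S$. The macroscopic fluxes in the variables $(\theta,\tau)$ are $$\Phi(\theta,\tau)=\sum_{\omega_1,\omega_2,\omega_1',\omega_2'\in S} r(\omega_1,\omega_2;\omega_1',\omega_2')(\xi(\omega_2')-\xi(\omega_2))\,\pi_{\theta,\tau}(\omega_1)\pi_{\theta,\tau}(\omega_2),$$ $$\Psi(\theta,\tau)=\sum_{\omega_1,\omega_2,\omega_1',\omega_2'\in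 S} r(\omega_1,\omega_2;\omega_1',\omega_2')(\eta(\omega_2')-\eta(\omega_2))\,\pi_{\theta,\tau}(\omega_1)\pi_{\theta,\tau}(\omega_2).$$ Primes with subscripts denote partial derivatives. *)

(* Defs.v *)
From HB Require Import structures.
From mathcomp Require Import all_boot all_order all_algebra.
From mathcomp Require Import all_classical all_reals all_analysis.
Import Order.TTheory GRing.Theory Num.Theory.
Import numFieldNormedType.Exports.

Set Implicit Arguments.
Unset Strict Implicit.
Unset Printing Implicit Defensive.

Local Open Scope ring_scope.

Section Model.
Context {R : realType} {S : finType}.

Implicit Types (xi eta zeta : S -> int) (r : S -> S -> S -> S -> R).
Implicit Types (pi : S -> R).

(* Probability measures on S are represented by their mass functions. *)
Definition is_prob pi : Prop :=
  (forall w, 0 <= pi w) /\ \sum_w pi w = 1.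

Definition lin_indep_with_one xi eta : bool :=
  free [:: [ffun w => (xi w)%:~R : R^o];
           [ffun w => (eta w)%:~R : R^o];
           [ffun _ : S => 1 : R^o]].

Definition conserves xi eta r : Prop :=
  forall w1 w2 w1' w2', 0 < r w1 w2 w1' w2' ->
    xi w1 + xi w2 = xi w1' + xi w2' /\ eta w1 + eta w2 = eta w1' + eta w2'.

(* In the reversed jump the two sites are swapped as well: the rate on the
   right is that of (w2', w1') -> (w2, w1). *)
Definition reversal_symmetric r pi : Prop :=
  forall w1 w2 w1' w2',
    pi w1 * pi w2 * r w1 w2 w1' w2' = pi w2' * pi w1' * r w2' w1' w2 w1.

Definition total_rate r (w1 w2 : S) : R :=
  \sum_w1' \sum_w2' r w1 w2 w1' w2'.

Definition cyclic_rates r : Prop :=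
  forall w1 w2 w3,
    total_rate r w1 w2 + total_rate r w2 w3 + total_rate r w3 w1 =
    total_rate r w1 w3 + total_rate r w3 w2 + total_rate r w2 w1.

Definition log_mgf xi eta pi (theta tau : R) : R :=
  ln (\sum_w expR (theta * (xi w)%:~R + tau * (eta w)%:~R) * pi w).

Definition tilted xi eta pi (theta tau : R) (w : S) : R :=
  pi w * expR (theta * (xi w)%:~R + tau * (eta w)%:~R
               - log_mgf xi eta pi theta tau).

(* Macroscopic flux of the quantity zeta, in the variables (theta, tau);
   Phi and Psi are obtained for zeta = xi and zeta = eta. *)
Definition flux zeta xi eta r pi (theta tau : R) : R :=
  \sum_w1 \sum_w2 \sum_w1' \sum_w2'
    r w1 w2 w1' w2' * (zeta w2' - zeta w2)%:~R
    * tilted xi eta pi theta tau w1 * tilted xi eta pi theta tau w2.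

Definition Phi xi eta r pi : R -> R -> R := flux xi xi eta r pi.
Definition Psi xi eta r pi : R -> R -> R := flux eta xi eta r pi.

End Model.

Arguments lin_indep_with_one R {S} xi eta.

(* Main.v *)
Require Import Defs.
From HB Require Import structures.
From mathcomp Require Import all_boot all_order all_algebra.
From mathcomp Require Import all_classical all_reals all_analysis.
From mathcomp Require Import ring lra.
Import Order.TTheory GRing.Theory Num.Theory.
Import numFieldNormedType.Exports.
Local Open Scope ring_scope.

(** Write [p] for the tilted measure at [(theta, tau)]. Conservation makes the
    tilting factors of the two sides of a jump equal, so [p], like [pi], is
    symmetric under reversal of the jumps ([tilted_reversal]). Reversal turns
    the value of [zeta] at the second site after a jump into its value at the
    first site before it, so the flux of [zeta] involves only total rates:
    it is the sum of [R(w1, w2) (zeta w1 - zeta w2) p(w1) p(w2)].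
    The cyclic condition says that the antisymmetric part of [R] is a cocycle,
    hence a coboundary [f w1 - f w2] ([cyclic_rates_potential]); antisymmetrizing
    the sum above shows that the flux of [zeta] is the covariance of [f] and
    [zeta] under [p] ([reversal_flux_cov]).

    Now [p] runs through an exponential family, where differentiating an
    expectation in [theta] gives the covariance with [xi], and in [tau] the
    covariance with [eta] ([is_derive_mean]). So [U], the expectation of [f]
    under [p], is a potential. Differentiating once more, both mixed derivatives
    are the third joint cumulant of [f], [xi] and [eta]. *)

(** * Means and covariances *)

Section Mean.
Context {R : realType} {S : finType}.
Implicit Types (p g h : S -> R).

Definition mean p g : R := \sum_w g w * p w.

Definition cov p g h : R := mean p (fun w => g w * h w) - mean p g * mean p h.

(** For two independent copies of a variable, the product of the differences has
    twice the covariance as its mean. *)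
Lemma sum_cross_differences p g h : \sum_w p w = 1 ->
  \sum_w1 \sum_w2 (g w1 - g w2) * (h w1 - h w2) * (p w1 * p w2) =
  2 * cov p g h.
Proof.
move=> p1; rewrite /cov mulrBr mulr2n !mulrDl !mul1r.
rewrite -[X in X + _ - _]mulr1 -[X in _ + X - _]mul1r -p1 opprD.
rewrite [X in _ + (_ - X)]mulrC /mean !big_distrlr/= -!sumrN -!big_split/=.
apply: eq_bigr => w1 _; rewrite -!sumrN -!big_split/=.
by apply: eq_bigr => w2 _; ring.
Qed.

End Mean.

(** * Fluxes under a reversal-symmetric measure *)

Section Reversal.
Context {R : realType} {S : finType}.
Implicit Types (r : S -> S -> S -> S -> R) (p f g : S -> R).

Lemma sum4_reverse (F : S -> S -> S -> S -> R) :
  \sum_a \sum_b \sum_c \sum_d F a b c d = \sum_a \sum_b \sum_c \sum_d F d c b a.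
Proof.
under eq_bigr do under eq_bigr do rewrite exchange_big/=.
rewrite pair_bigA; under eq_bigr do rewrite pair_bigA/=.
rewrite exchange_big/=.
rewrite -(pair_bigA _ (fun a b => \sum_(q : S * S) F q.1 q.2 b a))/=.
apply: eq_bigr => a _; apply: eq_bigr => b _.
by rewrite -(pair_bigA _ (fun c d => F c d b a))/= exchange_big.
Qed.

(** In the gain term, reversing the jump sends the second site after it to the
    first site before it; both terms then depend only on the state before the
    jump, and the sum over final states collapses to the total rate. *)
Lemma reversal_flux_total_rate {r p} g : reversal_symmetric r p ->
  \sum_w1 \sum_w2 \sum_w1' \sum_w2'
    r w1 w2 w1' w2' * (g w2' - g w2) * p w1 * p w2 =
  \sum_w1 \sum_w2 total_rate r w1 w2 * (g w1 - g w2) * (p w1 * p w2).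
Proof.
move=> rev.
have -> : \sum_w1 \sum_w2 \sum_w1' \sum_w2'
    r w1 w2 w1' w2' * (g w2' - g w2) * p w1 * p w2 =
    \sum_w1 \sum_w2 \sum_w1' \sum_w2' g w2' * (p w1 * p w2 * r w1 w2 w1' w2')
  - \sum_w1 \sum_w2 \sum_w1' \sum_w2' g w2 * (p w1 * p w2 * r w1 w2 w1' w2').
  do 4 (rewrite -sumrB; apply: eq_bigr => ? _).
  by ring.
rewrite sum4_reverse.
under eq_bigr do under eq_bigr do under eq_bigr do
  under eq_bigr do rewrite rev.
rewrite -sumrB; apply: eq_bigr => w1 _.
rewrite -sumrB; apply: eq_bigr => w2 _.
rewrite /total_rate !mulr_suml -sumrB; apply: eq_bigr => w1' _.
by rewrite !mulr_suml -sumrB; apply: eq_bigr => w2' _; ring.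
Qed.

(** Any fixed state serves as a base point for integrating the cocycle
    [R(w1, w2) - R(w2, w1)]. *)
Lemma cyclic_rates_potential {r} : cyclic_rates r ->
  exists f : S -> R, forall w1 w2,
    total_rate r w1 w2 - total_rate r w2 w1 = f w1 - f w2.
Proof.
move=> cyc; case: (pickP (fun _ : S => true)) => [w0 _|S0]; last first.
  by exists (fun=> 0) => w1; have := S0 w1.
exists (fun w => total_rate r w w0 - total_rate r w0 w) => w1 w2.
by have := cyc w1 w2 w0; lra.
Qed.

(** Exchanging the two sites and averaging replaces the total rate by half its
    antisymmetric part, here [f w1 - f w2]. *)
Lemma reversal_flux_cov {r p f} g : reversal_symmetric r p -> \sum_w p w = 1 ->
  (forall w1 w2, total_rate r w1 w2 - total_rate r w2 w1 = f w1 - f w2) ->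
  \sum_w1 \sum_w2 \sum_w1' \sum_w2'
    r w1 w2 w1' w2' * (g w2' - g w2) * p w1 * p w2 = cov p f g.
Proof.
move=> rev p1 fP; rewrite (reversal_flux_total_rate g rev).
set X := LHS.
have X2 : X + X = 2 * cov p f g.
  rewrite {2}/X exchange_big -big_split/= -sum_cross_differences//.
  apply: eq_bigr => w1 _; rewrite -big_split/=; apply: eq_bigr => w2 _.
  by rewrite -fP; ring.
by lra.
Qed.

End Reversal.

(** * The exponential family of tilted measures *)

Section ExponentialFamily.
Context {R : realType} {S : finType}.
Implicit Types (xi eta zeta : S -> int) (mu g h : S -> R)
  (r : S -> S -> S -> S -> R) (theta tau : R).

Local Notation real zeta := (fun w => (zeta w)%:~R).

Lemma is_derive_fsum (I : finType) (F : I -> R -> R) (dF : I -> R) (x : R) :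
  (forall i, is_derive x 1 (F i) (dF i)) ->
  is_derive x 1 (fun t => \sum_i F i t) (\sum_i dF i).
Proof.
move=> FdF; elim: (index_enum I) => [|i s IHs].
  under eq_fun do rewrite big_nil.
  by rewrite big_nil; exact: is_derive_cst.
under eq_fun do rewrite big_cons.
by rewrite big_cons; exact: is_deriveD.
Qed.

Lemma is_derive1_derive1 (F : R -> R) (x dF : R) :
  is_derive x 1 F dF -> derive1 F x = dF.
Proof. by move=> [_ <-]; exact: derive1E. Qed.

(** Exchanging the roles of the two quantities turns each statement about the
    derivative in [theta] into one about the derivative in [tau]. *)
Lemma tilted_swap xi eta mu theta tau :
  tilted xi eta mu theta tau = tilted eta xi mu tau theta.
Proof.
apply/funext => w; rewrite /tilted /log_mgf [tau * _ + _]addrC.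
by under [in RHS]eq_bigr do rewrite addrC.
Qed.

Lemma partition_gt0 xi eta {mu} theta tau : is_prob mu ->
  0 < \sum_w expR (theta * (xi w)%:~R + tau * (eta w)%:~R) * mu w.
Proof.
move=> [mu_ge0 mu1].
have term_ge0 w : true ->
    0 <= expR (theta * (xi w)%:~R + tau * (eta w)%:~R) * mu w.
  by move=> _; rewrite mulr_ge0 ?expR_ge0.
rewrite lt_def sumr_ge0// andbT; apply/negP => /eqP Z0.
have : \sum_w mu w = 0.
  apply: big1 => w _; have /eqP := psumr_eq0P term_ge0 Z0 (i := w) isT.
  by rewrite mulf_eq0 gt_eqF ?expR_gt0//= => /eqP.
by move/eqP; rewrite mu1 oner_eq0.
Qed.

Lemma tiltedE xi eta {mu} theta tau w : is_prob mu ->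
  tilted xi eta mu theta tau w =
  (\sum_v expR (theta * (xi v)%:~R + tau * (eta v)%:~R) * mu v)^-1 *
  (expR (theta * (xi w)%:~R + tau * (eta w)%:~R) * mu w).
Proof.
move=> /(partition_gt0 xi eta theta tau) Z_gt0.
by rewrite /tilted /log_mgf expRD expRN lnK ?posrE//; ring.
Qed.

Lemma sum_tilted xi eta {mu} theta tau : is_prob mu ->
  \sum_w tilted xi eta mu theta tau w = 1.
Proof.
move=> mu_prob; under eq_bigr do rewrite tiltedE//.
by rewrite -mulr_sumr mulVf// gt_eqF// partition_gt0.
Qed.

Lemma is_derive_log_mgf xi eta {mu} theta tau : is_prob mu ->
  is_derive theta 1 (fun t => log_mgf xi eta mu t tau)
    (mean (tilted xi eta mu theta tau) (real xi)).
Proof.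
move=> mu_prob; rewrite /log_mgf.
have dZ : is_derive theta 1
    (fun t => \sum_w expR (t * (xi w)%:~R + tau * (eta w)%:~R) * mu w)
    (\sum_w (xi w)%:~R *
       (expR (theta * (xi w)%:~R + tau * (eta w)%:~R) * mu w)).
  apply: is_derive_fsum => w; apply: is_derive_eq.
  by rewrite /GRing.scale/=; ring.
have dln := is_derive1_ln (partition_gt0 xi eta theta tau mu_prob).
apply: is_derive_eq.
rewrite /mean mulr_sumr; apply: eq_bigr => w _.
by rewrite tiltedE//; ring.
Qed.

Lemma is_derive_tilted xi eta {mu} theta tau w : is_prob mu ->
  is_derive theta 1 (fun t => tilted xi eta mu t tau w)
    (tilted xi eta mu theta tau w *
     ((xi w)%:~R - mean (tilted xi eta mu theta tau) (real xi))).
Proof.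
move=> /(is_derive_log_mgf xi eta theta tau) dG; rewrite /tilted.
apply: is_derive_eq.
by rewrite -/(tilted _ _ _ _ _) /GRing.scale/=; ring.
Qed.

(** The logarithmic derivative of the tilted mass in [theta] is the centred
    [xi], and pairing [g] with it gives a covariance. *)
Lemma is_derive_mean xi eta {mu} g theta tau : is_prob mu ->
  is_derive theta 1 (fun t => mean (tilted xi eta mu t tau) g)
    (cov (tilted xi eta mu theta tau) g (real xi)).
Proof.
move=> mu_prob; rewrite /mean.
have dp w := is_derive_tilted xi eta theta tau w mu_prob.
apply: is_derive_eq.
  by apply: is_derive_fsum => w; exact: (is_deriveM (is_derive_cst _ _ _)).
rewrite /cov {2}/mean mulr_suml -sumrB; apply: eq_bigr => w _.
by rewrite /GRing.scale/=; ring.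
Qed.

Lemma is_derive_cov xi eta {mu} g h theta tau : is_prob mu ->
  let p := tilted xi eta mu theta tau in
  is_derive theta 1 (fun t => cov (tilted xi eta mu t tau) g h)
    (cov p (fun w => g w * h w) (real xi)
     - (mean p g * cov p h (real xi) + mean p h * cov p g (real xi))).
Proof.
move=> mu_prob p.
have dmean k := is_derive_mean xi eta k theta tau mu_prob.
exact: (is_deriveB (dmean _) (is_deriveM (dmean g) (dmean h))).
Qed.

(** Conservation makes the exponents on both sides of a jump with positive rate
    agree. When the rate vanishes, the symmetry of [mu] makes the product of the
    reverse rate and the two masses vanish too, whatever the exponents. *)
Lemma tilted_reversal {xi eta r mu} theta tau :
  (forall w1 w2 w1' w2' : S, 0 <= r w1 w2 w1' w2') ->
  conserves xi eta r -> reversal_symmetric r mu ->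
  reversal_symmetric r (tilted xi eta mu theta tau).
Proof.
move=> r_ge0 cons rev w1 w2 w1' w2'.
have reorder (a b x y z : R) : a * x * (b * y) * z = x * y * (a * b * z).
  by ring.
rewrite /tilted (reorder (mu w1)) (reorder (mu w2')) -!expRD (rev w1).
have [r0|r_neq0] := eqVneq (r w1 w2 w1' w2') 0.
  by rewrite -(rev w1) r0 !mulr0.
have r_gt0 : 0 < r w1 w2 w1' w2' by rewrite lt_def r_neq0 r_ge0.
have [/(congr1 (intr : int -> R)) xiE /(congr1 (intr : int -> R)) etaE] :=
  cons _ _ _ _ r_gt0.
congr (expR _ * _); rewrite !rmorphD/= in xiE etaE.
have -> (x y x' y' z : R) :
    theta * x + tau * x' - z + (theta * y + tau * y' - z) =
    theta * (x + y) + tau * (x' + y') - (z + z) by ring.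
by rewrite xiE etaE; ring.
Qed.

Lemma flux_cov {xi eta r mu} (f : S -> R) zeta theta tau :
  (forall w1 w2 w1' w2' : S, 0 <= r w1 w2 w1' w2') ->
  conserves xi eta r -> is_prob mu -> reversal_symmetric r mu ->
  (forall w1 w2, total_rate r w1 w2 - total_rate r w2 w1 = f w1 - f w2) ->
  flux zeta xi eta r mu theta tau =
  cov (tilted xi eta mu theta tau) f (real zeta).
Proof.
move=> r_ge0 cons mu_prob rev fP.
rewrite -(reversal_flux_cov _ (tilted_reversal theta tau r_ge0 cons rev)
  (sum_tilted xi eta theta tau mu_prob) fP) /flux.
by do 4 (apply: eq_bigr => ? _); rewrite rmorphB.
Qed.

End ExponentialFamily.

Theorem lemma1 (R : realType) (S : finType) (xi eta : S -> int)
    (r : S -> S -> S -> S -> R) (pi : S -> R)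
    (indep : lin_indep_with_one R xi eta)
    (r_ge0 : forall w1 w2 w1' w2' : S, 0 <= r w1 w2 w1' w2')
    (condA : conserves xi eta r)
    (pi_prob : is_prob pi)
    (condC : reversal_symmetric r pi)
    (condD : cyclic_rates r) :
  (exists U : R -> R -> R, forall theta tau : R,
     is_derive theta 1 (fun t : R => U t tau) (Phi xi eta r pi theta tau) /\
     is_derive tau 1 (fun t : R => U theta t) (Psi xi eta r pi theta tau))
  /\
  (forall theta tau : R,
     [/\ derivable (fun t : R => Phi xi eta r pi theta t) tau 1,
         derivable (fun t : R => Psi xi eta r pi t tau) theta 1 &
         derive1 (fun t : R => Phi xi eta r pi theta t) tau =
         derive1 (fun t : R => Psi xi eta r pi t tau) theta]).
Proof.
have [f fP] := cyclic_rates_potential condD.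
have fluxE zeta : flux zeta xi eta r pi =
    fun theta tau => cov (tilted xi eta pi theta tau) f (fun w => (zeta w)%:~R).
  by apply/funext => theta; apply/funext => tau; exact: flux_cov.
have swapE t : tilted xi eta pi t = fun s => tilted eta xi pi s t.
  by apply/funext => s; exact: tilted_swap.
rewrite /Phi /Psi !fluxE; split.
  exists (fun theta tau => mean (tilted xi eta pi theta tau) f) => theta tau.
  by split; [|rewrite swapE]; exact: is_derive_mean.
move=> theta tau; rewrite !swapE.
have dPhi := is_derive_cov eta xi f (fun w => (xi w)%:~R) tau theta pi_prob.
have dPsi := is_derive_cov xi eta f (fun w => (eta w)%:~R) theta tau pi_prob.
split; [by case: dPhi|by case: dPsi|].
rewrite (is_derive1_derive1 _ _ _ dPhi) (is_derive1_derive1 _ _ _ dPsi).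
rewrite (tilted_swap eta xi); set p := tilted _ _ _ _ _.
(* Both sides are the third joint cumulant, up to the order of the factors. *)
rewrite /cov; under eq_fun do rewrite mulrAC.
rewrite [X in mean p f * (mean p X - _)](_ : _ =
  fun w => (eta w)%:~R * (xi w)%:~R).
  by ring.
by apply/funext => w; rewrite mulrC.
Qed.
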